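(* Let $(G,h)$ be a nilpotent Lie group endowed with a left-invariant Riemannian metric and let $\mathfrak{g}$ be its Lie algebra. Then the signature of the Ricci operator of $(G,h)$ belongs to $\mathbf{Sign}(\mathfrak{g})$.
   Context: All Lie groups and Lie algebras are real and finite-dimensional. The signature of a symmetric operator $A$ on a Euclidean vector space $V$ is the triple $(s^-,s^0,s^+)$, where $s^+$ (resp. $s^-$) is the sum of the dimensions of the eigenspaces of $A$ for positive (resp. negative) eigenvalues and $s^0=\dim\ker A$. A left-invariant Riemannian metric $h$ on $G$ is the same as an inner product $\langle\cdot,\cdot\rangle$ on $\mathfrak{g}$; the Ricci operator of $(G,h)$ is the symmetric endomorphism $\mathrm{Ric}$ of $\mathfrak{g}=T_eG$ with $\langle \mathrm{Ric}(u),v\rangle=\mathrm{ric}(u,v)$, where $\mathrm{ric}$ is the Ricci tensor of $h$ at $e$ (standard sign convention, for which round spheres have positive Ricci curvature). For a nilpotent Lie algebra $\mathfrak{g}$ of dimension $n$ with center $Z(\mathfrak{g})$ and derived ideal $[\mathfrak{g},\mathfrak{g}]$, put $d=\dim[\mathfrak{g},\mathfrak{g}]$, $k=\dim Z(\mathfrak{g})$, $\ell=\dim(Z(\mathfrak{g})\cap[\mathfrak{g},\mathfrak{g}])$. Then $$\mathbf{Sign}(\mathfrak{g})=\{(n-d-p+m^-,\;p+m^0,\;\ell+m^+):\ \max(k-d,0)\le p\le k-\ell,\ m^-+m^0+m^+=d-\ell\},$$ where $p,m^-,m^0,m^+$ range over nonnegative integers. *)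

(* Defs.v *)
From HB Require Import structures.
From mathcomp Require Import all_boot all_order all_algebra.
From mathcomp Require Import boolp classical_sets cardinality fsbigop reals.
From mathcomp Require Import ring.

Set Implicit Arguments.
Unset Strict Implicit.
Unset Printing Implicit Defensive.

Import Order.TTheory GRing.Theory Num.Theory passmx.
Local Open Scope classical_set_scope.
Local Open Scope ring_scope.

HB.mixin Record isLieAlgebra (K : fieldType) V of Vector K V := {
  lie : V -> V -> V;
  lie_linearl : forall y, linear (lie^~ y);
  lie_linearr : forall x, linear (lie x);
  liexx : forall x, lie x x = 0;
  jacobi : forall x y z,
    lie x (lie y z) + lie y (lie z x) + lie z (lie x y) = 0
}.

#[short(type="lieAlgType")]
HB.structure Definition LieAlgebra (K : fieldType) :=
  {V of isLieAlgebra K V & Vector K V}.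

HB.instance Definition _ (K : fieldType) (g : lieAlgType K) :=
  @bilinear_isBilinear.Build K g g g *:%R *:%R (@lie K g)
    (@lie_linearl K g, @lie_linearr K g).

HB.instance Definition _ (K : fieldType) (g : lieAlgType K) (x : g) :=
  GRing.isLinear.Build K g g *:%R (lie x) (lie_linearr x).

Section LieAlgebraTheory.
Variables (K : fieldType) (g : lieAlgType K).
Implicit Types (x y z : g) (U W : {vspace g}).

Lemma lieC x y : lie x y = - lie y x.
Proof.
have := liexx (x + y); rewrite linearDl !linearDr /= !liexx add0r addr0.
by move/eqP; rewrite addr_eq0 => /eqP.
Qed.

(* [U, W] is the span of all brackets; by bilinearity, bases suffice
   (see lie_span_subP). *)
Definition lie_span U W : {vspace g} :=
  <<[seq lie x y | x <- vbasis U, y <- vbasis W]>>%VS.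

Lemma memv_lie U W x y : x \in U -> y \in W -> lie x y \in lie_span U W.
Proof.
move=> /coord_vbasis -> /coord_vbasis ->.
rewrite linear_sumlz; apply: memv_suml => i _.
rewrite linear_sumr; apply: memv_suml => j _.
rewrite linearZl_LR linearZr_LR /=; do 2!apply: memvZ.
by apply: memv_span; apply: allpairs_f; rewrite mem_nth ?size_tuple.
Qed.

Lemma lie_span_subP U W (S : {vspace g}) :
  reflect (forall x y, x \in U -> y \in W -> lie x y \in S)
          (lie_span U W <= S)%VS.
Proof.
apply: (iffP idP) => [/subvP sUWS x y xU yW|UWS].
  by apply: sUWS; apply: memv_lie.
apply/span_subvP => z /allpairsP[[x y] /= [xU yW ->]].
by apply: UWS; apply: vbasis_mem.
Qed.

Definition derived_ideal : {vspace g} := lie_span fullv fullv.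

Definition center : {vspace g} :=
  lker (linfun (fun x => linfun (lie x) : 'End(g))).

Lemma centerP x : reflect (forall y, lie x y = 0) (x \in center).
Proof.
have lin : linear (fun x => linfun (lie x) : 'End(g)).
  move=> a u v; apply/lfunP => w.
  by rewrite add_lfunE scale_lfunE !lfunE /= linearDl linearZl_LR.
pose lin_ad := GRing.isLinear.Build _ _ _ _ _ lin.
pose ad : {linear g -> 'End(g)} := HB.pack (fun x => linfun (lie x) : 'End(g)) lin_ad.
have adE : linfun (fun x => linfun (lie x) : 'End(g)) x = linfun (lie x).
  exact: (lfunE ad x).
rewrite memv_ker adE; apply: (iffP eqP) => [/lfunP e y|e].
  by have := e y; rewrite lfunE /= zero_lfunE.
by apply/lfunP => y; rewrite lfunE /= zero_lfunE.
Qed.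

Fixpoint lower_central (i : nat) : {vspace g} :=
  if i is j.+1 then lie_span fullv (lower_central j) else fullv.

Definition nilpotent_lie : Prop := exists i, lower_central i = 0%VS.

(* Truncated subtraction is harmless: l <= k, l <= d, and
   p <= k - l = dim (center + derived_ideal) - d <= n - d. *)
Definition Sign : set (nat * nat * nat) :=
  let n := \dim {:g} in
  let d := \dim derived_ideal in
  let k := \dim center in
  let l := \dim (center :&: derived_ideal)%VS in
  [set s | exists p m_neg m_zero m_pos : nat,
     [/\ (maxn (k - d) 0 <= p <= k - l)%N,
         (m_neg + m_zero + m_pos = d - l)%N &
         s = (n - d - p + m_neg, p + m_zero, l + m_pos)%N]].

End LieAlgebraTheory.

Arguments derived_ideal {K} g.
Arguments center {K} g.
Arguments lower_central {K} g i.
Arguments nilpotent_lie {K} g.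
Arguments Sign {K} g.

Section Endomorphisms.
Variables (R : realType) (V : vectType R).
Implicit Type A : 'End(V).

Definition lfun_trace A : R := \tr (mxof (vbasis {:V}) (vbasis {:V}) A).

Lemma lfun_trace_linear : linear_for *%R lfun_trace.
Proof. by move=> a A B; rewrite /lfun_trace !linearP. Qed.

Lemma finite_leigenvalue A : finite_set [set a | leigenvalue A a].
Proof.
pose e := vbasis {:V}; pose p := char_poly (mxof e e A).
have p_neq0 : p != 0 by rewrite monic_neq0 ?char_poly_monic.
have [rs rsP] : exists rs : seq R, forall a, root p a -> a \in rs.
  elim: {p}(size p) {-2}p (leqnn (size p)) p_neq0 => [|m IH] p.
    by rewrite leqn0 size_poly_eq0 => /eqP ->; rewrite eqxx.
  move=> sp p0; have [[a pa]|nr] := pselect (exists a, root p a); last first.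
    by exists [::] => a pa; case: nr; exists a.
  have /factor_theorem[q pE] := pa.
  have q0 : q != 0 by apply: contraNneq p0 => q0; rewrite pE q0 mul0r.
  have sq : (size q <= m)%N.
    by move: sp; rewrite pE size_Mmonic ?monicXsubC // size_XsubC addn2.
  have [rs rsP] := IH _ sq q0.
  exists (a :: rs) => b; rewrite pE rootM root_XsubC in_cons.
  by case/orP => [/rsP ->|->]; rewrite ?orbT.
apply: (@sub_finite_set _ _ [set` rs]) => [a /= Aa|]; last exact: finite_seq.
apply: rsP; rewrite -eigenvalue_root_char.
apply: contra_neqN Aa => /eqP; rewrite (leigenspaceE (vbasisP _)) => ->.
exact: vsof0 (vbasisP _).
Qed.

(* Finitely supported sums, by finite_leigenvalue: the eigenspace is 0 when a
   is not an eigenvalue. *)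
Definition signature A : nat * nat * nat :=
  (\big[addn/0%N]_(a \in [set a : R | a < 0]) \dim (leigenspace A a),
   \dim (lker A),
   \big[addn/0%N]_(a \in [set a : R | 0 < a]) \dim (leigenspace A a)).

End Endomorphisms.

Section MetricLieAlgebra.
Variables (R : realType) (g : lieAlgType R) (ip : {dot g for idfun}).
Implicit Types (u v w x y : g).

Lemma ipC u v : ip u v = ip v u.
Proof. by rewrite (@hermC R false idfun) expr0 mul1r. Qed.

(* The vector representing a linear form; xget picks 0 if there is none, which
   does not happen for linear phi (riesz_sharpE). *)
Definition riesz_sharp (phi : g -> R) : g :=
  xget 0 [set x | forall w, ip x w = phi w].

Lemma ip_inj x y : (forall w, ip x w = ip y w) -> x = y.
Proof.
move=> xy; apply/eqP; rewrite -subr_eq0; apply: contraT => /(@neq0_dnorm_gt0 _ _ _ ip).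
by rewrite linearBl /= xy subrr ltxx.
Qed.

Lemma riesz_sharpE (phi : g -> R) w :
  linear_for *%R phi -> ip (riesz_sharp phi) w = phi w.
Proof.
move=> phi_lin; rewrite /riesz_sharp; case: xgetP => [x _ /(_ w) //|].
pose flat0 x : 'Hom(g, R^o) := linfun (applyr ip x : g -> R^o).
have flat0E x z : flat0 x z = ip x z by rewrite lfunE /= ipC.
have lin : linear flat0.
  move=> a u v; apply/lfunP => z.
  by rewrite add_lfunE scale_lfunE !flat0E linearDl linearZl_LR.
pose lin_flat := GRing.isLinear.Build _ _ _ _ _ lin.
pose flat : {linear g -> 'Hom(g, R^o)} := HB.pack flat0 lin_flat.
pose lin_phi := GRing.isLinear.Build R g R^o _ (phi : g -> R^o) phi_lin.
pose phiL : {linear g -> R^o} := HB.pack (phi : g -> R^o) lin_phi.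
have ker0 : lker (linfun flat) == 0%VS.
  apply/lker0P => x y; rewrite !lfunE /= => /lfunP xy.
  by apply: ip_inj => z; rewrite -!flat0E; exact: xy.
have img : limg (linfun flat) = fullv.
  apply/eqP; rewrite eqEdim subvf limg_dim_eq ?(eqP ker0) ?capv0 //.
  by rewrite !dimvf /dim /= muln1.
have : linfun phiL \in limg (linfun flat) by rewrite img memvf.
case/memv_imgP => x _ /lfunP phix none; case: (none x) => z.
by rewrite -flat0E -[LHS]/(flat x z) -(lfunE flat) -phix lfunE.
Qed.

(* If g is the Lie algebra (left-invariant fields) of G, ip is a left-invariant
   Riemannian metric on G and levi_civita is its Levi-Civita connection on
   left-invariant fields: in Koszul's formula, the derivatives of the constant
   functions ip u v vanish. *)
Definition levi_civita u v : g :=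
  riesz_sharp (fun w =>
    (ip (lie u v) w - ip (lie v w) u + ip (lie w u) v) / 2).

Lemma levi_civitaE u v w :
  ip (levi_civita u v) w = (ip (lie u v) w - ip (lie v w) u + ip (lie w u) v) / 2.
Proof.
rewrite riesz_sharpE // => a x y.
by rewrite !(linearDr, linearDl, linearZr_LR, linearZl_LR) /=; field.
Qed.

Lemma levi_civita_torsion_free u v :
  levi_civita u v - levi_civita v u = lie u v.
Proof.
apply: ip_inj => w; rewrite linearBl /= !levi_civitaE.
by rewrite (lieC v u) (lieC u w) (lieC w v) !linearNl /=; field.
Qed.

Lemma levi_civita_metric u v w :
  ip (levi_civita u v) w + ip v (levi_civita u w) = 0.
Proof.
rewrite (ipC v) !levi_civitaE (lieC w v) (lieC w u) (lieC v u) !linearNl /=.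
by field.
Qed.

Lemma levi_civita_bilinear : bilinear_for *:%R *:%R levi_civita.
Proof.
by split=> [v a x y|u a x y]; apply: ip_inj => w; rewrite linearDl linearZl_LR /=;
  rewrite !levi_civitaE !(linearDr, linearDl, linearZr_LR, linearZl_LR) /=; field.
Qed.

HB.instance Definition _ :=
  @bilinear_isBilinear.Build R g g g *:%R *:%R levi_civita levi_civita_bilinear.

Definition curvature u v w : g :=
  levi_civita u (levi_civita v w) - levi_civita v (levi_civita u w)
  - levi_civita (lie u v) w.

Lemma curvature_linear1 v w : linear (fun u => curvature u v w).
Proof.
move=> a x y; apply: ip_inj => z; rewrite /curvature.
rewrite !(linearDr, linearDl, linearZr_LR, linearZl_LR, linearNl, linearNr) /=.
by ring.
Qed.

Lemma curvature_linear2 u w : linear (fun v => curvature u v w).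
Proof.
move=> a x y; apply: ip_inj => z; rewrite /curvature.
rewrite !(linearDr, linearDl, linearZr_LR, linearZl_LR, linearNl, linearNr) /=.
by ring.
Qed.

Lemma curvature_linear3 u v : linear (curvature u v).
Proof.
move=> a x y; apply: ip_inj => z; rewrite /curvature.
rewrite !(linearDr, linearDl, linearZr_LR, linearZl_LR, linearNl, linearNr) /=.
by ring.
Qed.

(* With the sign of curvature above, this trace is positive on round spheres. *)
Definition ricci v w : R := lfun_trace (linfun (fun u => curvature u v w)).

Lemma curvature_lfunE u v w :
  linfun (fun x => curvature x v w) u = curvature u v w.
Proof.
pose lin := GRing.isLinear.Build _ _ _ _ _ (curvature_linear1 v w).
pose f : {linear g -> g} := HB.pack (fun x => curvature x v w) lin.
exact: (lfunE f).
Qed.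

Lemma ricci_linear1 w : linear_for *%R (fun v => ricci v w).
Proof.
move=> a x y; rewrite /ricci -lfun_trace_linear; congr lfun_trace.
apply/lfunP => u; rewrite add_lfunE scale_lfunE !curvature_lfunE.
exact: curvature_linear2.
Qed.

Lemma ricci_linear2 v : linear_for *%R (ricci v).
Proof.
move=> a x y; rewrite /ricci -lfun_trace_linear; congr lfun_trace.
apply/lfunP => u; rewrite add_lfunE scale_lfunE !curvature_lfunE.
exact: curvature_linear3.
Qed.

Definition ricci_operator : 'End(g) :=
  linfun (fun u => riesz_sharp (ricci u)).

Lemma ricci_operatorE u v : ip (ricci_operator u) v = ricci u v.
Proof.
have lin : linear (fun u => riesz_sharp (ricci u)).
  move=> a x y; apply: ip_inj => w; rewrite linearDl linearZl_LR /=.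
  by rewrite !(riesz_sharpE _ (ricci_linear2 _)) ricci_linear1.
pose lin_f := GRing.isLinear.Build _ _ _ _ _ lin.
pose f : {linear g -> g} := HB.pack (fun u => riesz_sharp (ricci u)) lin_f.
have -> : ricci_operator u = f u by exact: (lfunE f).
exact: riesz_sharpE (ricci_linear2 _).
Qed.

End MetricLieAlgebra.

(* Main.v *)
(* For nilpotent g the Killing form vanishes and, in an orthonormal basis e,
     ric(u, u) = - 1/2 \sum_i |[u, e_i]|^2 + 1/4 \sum_(i, j) <[e_i, e_j], u>^2.
   Let D = [g, g] and let Z be the center.  The first sum vanishes exactly on Z
   and the second exactly on the orthogonal complement O of D.  Hence ric is
   positive definite on Z :&: D, negative definite on any complement of Z :&: O
   in O, and Z :&: O lies in the kernel of the Ricci operator.  By the spectral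
   theorem this bounds the three entries of the signature from below, with
   p = \dim (Z :&: O), and their sum is the dimension of g. *)
Require Import Defs.
From mathcomp Require Import all_boot all_order all_algebra.
From mathcomp Require Import classical_sets fsbigop reals.
From mathcomp Require Import complex zify ring lra.

Set Implicit Arguments.
Unset Strict Implicit.
Unset Printing Implicit Defensive.

Import Order.TTheory GRing.Theory Num.Theory passmx.
Local Open Scope ring_scope.

(** * Trace of a nilpotent matrix *)

(** If M^k = 0, then X - M divides X^k - M^k = X^k as polynomial matrices. Taking determinants, the
    characteristic polynomial divides a power of X, so in size n > 0 it is X^n, and its coefficient
    of degree n - 1, which is - tr M, vanishes. *)
Lemma mxtrace_nilpotent (F : fieldType) n (M : 'M[F]_n) k :
  (forall v : 'rV_n, iter k (mulmxr M) v = 0) -> \tr M = 0.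
Proof.
case: n M => [|n] M Mk; first by rewrite /mxtrace big_ord0.
have Mk0 : M ^+ k = 0.
  have iterM v : iter k (mulmxr M) v = v *m M ^+ k.
    elim: k v {Mk} => [|k IH] v; first by rewrite mulmx1.
    by rewrite iterS IH /= exprSr mulmxA.
  by apply/row_matrixP => i; rewrite rowE -iterM Mk row0.
have dvdXk : char_poly M %| ('X - 0%:P) ^+ (k * n.+1).
  pose N := map_mx (@polyC F) M.
  have Nk0 : N ^+ k = 0 by rewrite /N -rmorphXn /= Mk0 map_mx0.
  have Xk : ('X%:M : 'M[{poly F}]_n.+1) ^+ k = ('X^k)%:M by rewrite -rmorphXn.
  have cXN : GRing.comm ('X%:M : 'M[{poly F}]_n.+1) N.
    by apply: esym; apply: (scalar_mxC _ N).
  have := subrXX_comm k cXN; rewrite Nk0 subr0 Xk => /(congr1 determinant).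
  by rewrite det_scalar -[_ * _]/(_ *m _) det_mulmx -exprM subr0 => ->; rewrite dvdp_mulr.
have [j _] := dvdp_exp_XsubCP dvdXk; rewrite subr0.
rewrite eqp_monic ?char_poly_monic ?monicXn // => /eqP chiE.
have jn : j = n.+1.
  by have := size_char_poly M; rewrite chiE size_polyXn => -[].
have := @char_poly_trace _ _ M isT.
rewrite chiE jn coefXn /= -[n == _]/(n == n.+1) ltn_eqF // => /esym/eqP.
by rewrite oppr_eq0 => /eqP.
Qed.

(** * Spectral theorem on Euclidean spaces *)

(** Serves to split a complex eigenvector equation of a real matrix into its real and imaginary
    parts. *)
Lemma complex_mulE (R : rcfType) (s t : R) (l w : R[i]%C) :
  s%:C%C + 'i%C * t%:C%C = l * w ->
  s = complex.Re l * complex.Re w - complex.Im l * complex.Im w /\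
  t = complex.Im l * complex.Re w + complex.Re l * complex.Im w.
Proof.
case: l => a b; case: w => c d; simpc => -[-> ->].
by split; rewrite // addrC.
Qed.

Section Spectral.
Variables (R : rcfType) (V : vectType R) (ip : {dot V for idfun}).
Implicit Types (u v w : V) (U : {vspace V}) (A : 'End(V)).

Lemma dotC u v : ip u v = ip v u.
Proof. by rewrite (@hermC R false idfun) expr0 mul1r. Qed.

Lemma dot_ge0 u : 0 <= ip u u.
Proof.
by have [->|/(@neq0_dnorm_gt0 _ _ _ ip)/ltW //] := eqVneq u 0; rewrite linear0l.
Qed.

Lemma dot_eq0 u : (ip u u == 0) = (u == 0).
Proof.
have [->|/(@neq0_dnorm_gt0 _ _ _ ip)/gt_eqF //] := eqVneq u 0.
by rewrite linear0l eqxx.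
Qed.

Lemma mem_orthov_line u v : (u \in orthov ip <[v]>) = (ip u v == 0).
Proof. exact: mem_orthov1. Qed.

Lemma capv_orthov U : (U :&: orthov ip U = 0)%VS.
Proof.
apply/eqP; rewrite -subv0; apply/subvP => u /memv_capP[uU /mem_orthovP uO].
by rewrite memv0 -dot_eq0 [ip u u]uO.
Qed.

Definition self_adjoint A := forall u v, ip (A u) v = ip u (A v).

(* The matrix of [A] on [U] has a complex eigenvector [x + iy]; self-adjointness
   gives [b (|x|^2 + |y|^2) = 0] for the imaginary part [b] of its eigenvalue. *)
Lemma self_adjoint_eigenvector A U : self_adjoint A -> (A @: U <= U)%VS ->
  U != 0%VS -> exists u a, [/\ u \in U, u != 0 & A u = a *: u].
Proof.
move=> symA AU; rewrite -dimv_eq0; case E: (\dim U) => [//|n] _.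
move: (vbasisP U); move: (vbasis U); rewrite E => e eU.
have eiU (i : 'I_n.+1) : e`_i \in U by rewrite (basis_mem eU) // mem_nth // size_tuple.
pose B := \matrix_(i < n.+1, j < n.+1) coord e j (A e`_i).
pose vec (x : 'rV[R]_n.+1) := \sum_i x 0 i *: e`_i.
have vecU x : vec x \in U by rewrite memv_suml // => i _; rewrite memvZ.
have vecD a b x y : vec (a *: x + b *: y) = a *: vec x + b *: vec y.
  rewrite /vec !scaler_sumr -big_split; apply: eq_bigr => i _.
  by rewrite !mxE scalerDl !scalerA.
have vec0 x : vec x = 0 -> x = 0.
  move=> x0; apply/rowP => i; rewrite mxE.
  by have := coord_sum_free (x 0) i (basis_free eU); rewrite -/(vec x) x0 linear0.
have Avec x : A (vec x) = vec (x *m B).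
  rewrite /vec linear_sum /=.
  under [RHS]eq_bigr => j _ do rewrite mxE scaler_suml.
  rewrite exchange_big /=; apply: eq_bigr => i _; rewrite linearZ /=.
  have AeU : A e`_i \in U by rewrite (subvP AU) // memv_img.
  rewrite {1}(coord_basis eU AeU) scaler_sumr; apply: eq_bigr => j _.
  by rewrite mxE scalerA.
(* [R[i]] is algebraically closed, so the real matrix [B] has a complex eigenvalue. *)
have [l] : exists l, root (char_poly (map_mx (real_complex R) B)) l.
  by apply: closed_rootP; rewrite size_char_poly.
rewrite -eigenvalue_root_char => /eigenvalueP[z zB z0].
pose x := map_mx (@complex.Re R) z; pose y := map_mx (@complex.Im R) z.
have zE : z = map_mx (real_complex R) x + 'i%C *: map_mx (real_complex R) y.
  by apply/rowP => j; rewrite !mxE -complexE.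
have [xB yB] : x *m B = complex.Re l *: x + (- complex.Im l) *: y /\
               y *m B = complex.Im l *: x + complex.Re l *: y.
  have zBE : map_mx (real_complex R) (x *m B) +
      'i%C *: map_mx (real_complex R) (y *m B) = l *: z.
    by rewrite -zB [in RHS]zE mulmxDl -scalemxAl !map_mxM.
  split; apply/rowP => j; have := congr1 (fun m : 'rV_n.+1 => m 0 j) zBE;
    rewrite !mxE => /complex_mulE[E1 E2].
    by rewrite E1 mulNr.
  by rewrite E2.
have Ax : A (vec x) = complex.Re l *: vec x + (- complex.Im l) *: vec y.
  by rewrite Avec xB vecD.
have Ay : A (vec y) = complex.Im l *: vec x + complex.Re l *: vec y.
  by rewrite Avec yB vecD.
have Im0 : complex.Im l * (ip (vec x) (vec x) + ip (vec y) (vec y)) = 0.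
  have := symA (vec x) (vec y); rewrite Ax Ay !(linearDl, linearDr) /=.
  rewrite !(linearZl_LR, linearZr_LR) /=.
  lra.
have xy0 : ip (vec x) (vec x) + ip (vec y) (vec y) != 0.
  apply: contraNneq z0 => /eqP; rewrite paddr_eq0 ?dot_ge0 // !dot_eq0.
  case/andP => /eqP/vec0 x0 /eqP/vec0 y0.
  by rewrite zE x0 y0 !map_mx0 scaler0 addr0.
have {Im0} l0 : complex.Im l = 0.
  by apply/eqP; move/eqP: Im0; rewrite mulf_eq0 (negPf xy0) orbF.
(* Now that [l] is real, [vec x] and [vec y] both satisfy the eigenvector equation, and by [xy0]
   they are not both zero. *)
have [vx0|vx0] := eqVneq (vec x) 0; last first.
  by exists (vec x), (complex.Re l); rewrite vecU vx0 Ax l0 oppr0 scale0r addr0.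
exists (vec y), (complex.Re l); rewrite vecU Ay l0 scale0r add0r; split=> //.
by apply: contraNneq xy0 => vy0; rewrite vx0 vy0 linear0l addr0.
Qed.

Lemma dim_capv_orthov1 u U : u \in U -> u != 0 ->
  (\dim (U :&: orthov ip <[u]>)).+1 = \dim U.
Proof.
move=> uU u0; rewrite -(@eq_dim_orthov1 _ _ _ _ ip) ?prednK //.
  by rewrite lt0n dimv_eq0; apply: contraNneq u0 => U0; move: uU; rewrite U0 memv0.
by apply/mem_orthovPn; exists u; rewrite // dot_eq0.
Qed.

(** Induction on the dimension: split off an eigenvector [u]; by self-adjointness its orthogonal
    complement in [U] is again stable. Quantifying over stable subspaces keeps the induction inside
    [V], with no restriction of [A]. *)
Lemma spectral_theorem_on A n U : self_adjoint A -> (A @: U <= U)%VS ->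
  \dim U = n -> exists (e : 'I_n -> V) (lam : 'I_n -> R),
    [/\ forall i, e i \in U, forall i j, ip (e i) (e j) = (i == j)%:R &
        forall i, A (e i) = lam i *: e i].
Proof.
move=> symA; elim: n U => [|n IH] U AU dU.
  by exists (fun=> 0), (fun=> 0); split=> -[].
have [u [a [uU u0 Au]]] : exists u a, [/\ u \in U, u != 0 & A u = a *: u].
  by apply: self_adjoint_eigenvector; rewrite // -dimv_eq0 dU.
have uu0 : 0 < ip u u by rewrite lt_def dot_eq0 u0 dot_ge0.
pose W := (U :&: orthov ip <[u]>)%VS.
have AW : (A @: W <= W)%VS.
  apply/subvP => x /memv_imgP[w /memv_capP[wU wu] ->{x}].
  have {}wu : ip w u = 0 by apply/eqP; rewrite -mem_orthov_line.
  apply/memv_capP; split; first by rewrite (subvP AU) // memv_img.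
  by rewrite mem_orthov_line symA Au linearZr_LR /= wu mulr0.
have dW : \dim W = n by apply: succn_inj; rewrite dim_capv_orthov1.
have [e [lam [eW ee Ae]]] := IH W AW dW.
have eu i : ip (e i) u = 0.
  by have /memv_capP[_] := eW i; rewrite mem_orthov_line => /eqP.
pose c := (Num.sqrt (ip u u))^-1.
have cuu : c * (c * ip u u) = 1.
  by rewrite mulrA -expr2 exprVn sqr_sqrtr ?ltW // mulVf ?gt_eqF.
(* Index [ord0] carries the normalized [u]; the other indices carry the family obtained on [W]. *)
exists (fun i => if unlift ord0 i is Some j then e j else c *: u).
exists (fun i => if unlift ord0 i is Some j then lam j else a).
split=> [i|i j|i].
- case: unliftP => [j _|_]; last exact: memvZ.
  by have /memv_capP[] := eW j.
- case: (unliftP ord0 i) => [i' ->|->]; case: (unliftP ord0 j) => [j' ->|->].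
  + by rewrite ee (inj_eq lift_inj).
  + by rewrite linearZr_LR /= eu mulr0.
  + by rewrite linearZl_LR /= dotC eu mulr0.
  + by rewrite linearZl_LR linearZr_LR /= cuu.
- case: unliftP => [j _|_]; first exact: Ae.
  by rewrite linearZ /= Au !scalerA mulrC.
Qed.

(** The zero endomorphism is self-adjoint and stabilizes every subspace, so the spectral theorem
    applies to it. *)
Lemma exists_orthonormal_basis U : exists2 e : 'I_(\dim U) -> V,
  forall i, e i \in U & forall i j, ip (e i) (e j) = (i == j)%:R.
Proof.
have [|||e [_ [eU ee _]]] := @spectral_theorem_on 0 (\dim U) U; last by exists e.
- by move=> u v; rewrite !zero_lfunE linear0l linear0r.
- by apply/subvP => _ /memv_imgP[u _ ->]; rewrite zero_lfunE mem0v.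
- by [].
Qed.

Lemma orthonormal_free (I : eqType) (e : I -> V) (s : seq I) :
  (forall i j, ip (e i) (e j) = (i == j)%:R) -> uniq s -> free (map e s).
Proof.
move=> ee; elim: s => [|i s IH] /=; first by rewrite nil_free.
case/andP=> si /IH fs; rewrite free_cons fs andbT; apply/negP => ei.
have /subvP/(_ _ ei) : (<<map e s>> <= orthov ip <[e i]>)%VS.
  apply/span_subvP => _ /mapP[j sj ->]; rewrite mem_orthov_line ee.
  by have [ji|_] := eqVneq j i; [rewrite -ji sj in si|rewrite eqxx].
by rewrite mem_orthov_line ee eqxx oner_eq0.
Qed.

Lemma dim_orthov U : (\dim U + \dim (orthov ip U))%N = \dim {:V}.
Proof.
have [e eU ee] := exists_orthonormal_basis U.
(* [s] is the orthogonal projection onto [U]; the decomposition v = s v + (v - s v) shows that [U]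
   and its orthogonal fill the space. *)
pose s v := \sum_i ip v (e i) *: e i.
have sU v : s v \in U by rewrite memv_suml // => i _; rewrite memvZ.
have spanU : <<[seq e i | i <- enum predT]>>%VS = U.
  apply/eqP; rewrite eqEdim; apply/andP; split.
    by apply/span_subvP => _ /mapP[i _ ->].
  have /eqP -> := orthonormal_free ee (enum_uniq predT).
  by rewrite size_map -cardE card_ord.
have sO v : v - s v \in orthov ip U.
  rewrite mem_orthov_sym -{1}spanU; apply/span_subvP => _ /mapP[j _ ->].
  rewrite mem_orthov_line linearBr /= subr_eq0.
  rewrite linear_sumr (bigD1 j) //= linearZr_LR /= ee eqxx mulr1.
  rewrite big1 => [|i ij]; last by rewrite linearZr_LR /= ee eq_sym (negPf ij) mulr0.
  by rewrite addr0 dotC.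
rewrite -dimv_disjoint_sum ?capv_orthov //; congr (\dim _); apply/eqP; rewrite eqEsubv subvf /=; apply/subvP => v _.
by rewrite -(subrK (s v) v) addrC memv_add.
Qed.

(** * Coordinates and eigenvalue counts in an orthonormal basis *)

Section OrthonormalBasis.
Variable e : 'I_(\dim {:V}) -> V.
Hypothesis ee : forall i j, ip (e i) (e j) = (i == j)%:R.

Lemma dim_orthonormal_span (P : pred 'I_(\dim {:V})) :
  \dim <<[seq e i | i <- enum P]>> = #|P|.
Proof.
have /eqP := orthonormal_free ee (enum_uniq P).
by rewrite size_map -cardE.
Qed.

Lemma orthonormal_spanf : <<[seq e i | i <- enum predT]>>%VS = fullv.
Proof.
by apply/eqP; rewrite eqEdim subvf dim_orthonormal_span card_ord leqnn.
Qed.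

Lemma orthonormal_expansion v : v = \sum_i ip v (e i) *: e i.
Proof.
set s := \sum_i _; apply/eqP; rewrite -subr_eq0 -dot_eq0.
(* [v - s] is orthogonal to every [e j], hence to the whole space and in particular to itself. *)
have /subvP/(_ (v - s)) : ({:V} <= orthov ip <[v - s]>)%VS.
  rewrite -orthonormal_spanf; apply/span_subvP => _ /mapP[j _ ->].
  rewrite mem_orthov_line dotC linearBl /= subr_eq0.
  rewrite linear_sumlz (bigD1 j) //= linearZl_LR /= ee eqxx mulr1.
  rewrite big1 ?addr0 // => i ij.
  by rewrite linearZl_LR /= ee (negPf ij) mulr0.
by rewrite mem_orthov_line; apply; rewrite memvf.
Qed.

Lemma parseval u v : ip u v = \sum_i ip u (e i) * ip v (e i).
Proof.
rewrite {1}(orthonormal_expansion u) linear_sumlz; apply: eq_bigr => i _.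
by rewrite linearZl_LR /= (dotC (e i)).
Qed.

Section Eigenbasis.
Variables (A : 'End(V)) (lam : 'I_(\dim {:V}) -> R).
Hypotheses (symA : self_adjoint A) (Ae : forall i, A (e i) = lam i *: e i).

Lemma dim_leigenspace a : \dim (leigenspace A a) = #|[pred i | lam i == a]|.
Proof.
rewrite -dim_orthonormal_span; congr (\dim _).
have mem_eigen v : (v \in leigenspace A a) = (A v == a *: v).
  by rewrite memv_ker add_lfunE opp_lfunE scale_lfunE id_lfunE subr_eq0.
apply/eqP; rewrite eqEsubv; apply/andP; split; last first.
  apply/span_subvP => x /mapP[i li ->{x}].
  by move: li; rewrite mem_enum mem_eigen Ae => /eqP ->.
apply/subvP => v; rewrite mem_eigen => /eqP Av.
rewrite (orthonormal_expansion v); apply: memv_suml => i _.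
have [la|la] := eqVneq (lam i) a.
  by apply/memvZ/memv_span/map_f; rewrite mem_enum inE la.
suff -> : ip v (e i) = 0 by rewrite scale0r mem0v.
(* Self-adjointness gives (a - lam i) <v, e i> = 0. *)
have := symA v (e i); rewrite Av Ae linearZl_LR linearZr_LR /=.
move/eqP; rewrite eq_sym -subr_eq0 -mulrBl mulf_eq0 subr_eq0 (negPf la).
by move/eqP.
Qed.

Lemma dot_eigenbasis u : ip (A u) u = \sum_i lam i * ip u (e i) ^+ 2.
Proof.
rewrite parseval; apply: eq_bigr => i _.
by rewrite symA Ae linearZr_LR /= expr2 mulrA.
Qed.

(** The span [W] of the eigenvectors with nonpositive eigenvalue carries a nonpositive form, so it
    meets [U] only in 0; the dimensions of [U] and [W] then add up to at most that of [V]. *)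
Lemma dim_positive_le U : (forall u, u \in U -> u != 0 -> 0 < ip (A u) u) ->
  (\dim U <= #|[pred i | (0 < lam i)%R]|)%N.
Proof.
move=> Upos; pose W := <<[seq e i | i <- enum [pred i | ~~ (0 < lam i)%R]]>>%VS.
have UW : (U :&: W)%VS = 0%VS.
  apply/eqP; rewrite -subv0; apply/subvP => u /memv_capP[uU uW].
  rewrite memv0; apply: contraT => u0; have := Upos u uU u0.
  rewrite ltNge dot_eigenbasis; case/negP; apply: sumr_le0 => i _.
  have [li|li] := boolP (0 < lam i); last first.
    by rewrite mulr_le0_ge0 ?sqr_ge0 // leNgt.
  suff -> : ip u (e i) = 0 by rewrite expr0n mulr0.
  apply/eqP; rewrite -mem_orthov_line; move: u uW {uU u0}; apply/subvP.
  apply/span_subvP => x /mapP[j lj ->{x}]; move: lj; rewrite mem_enum inE => lj.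
  rewrite mem_orthov_line ee.
  by have [ij|_] := eqVneq i j; [rewrite -ij li in lj|rewrite eqxx].
rewrite -(leq_add2r #|[pred i | ~~ (0 < lam i)%R]|) cardC card_ord.
rewrite -dim_orthonormal_span -/W -(dimv_disjoint_sum UW).
exact: dimvS (subvf _).
Qed.

End Eigenbasis.
End OrthonormalBasis.

Lemma dim_negative_le A lam (e : 'I_(\dim {:V}) -> V) U :
  (forall i j, ip (e i) (e j) = (i == j)%:R) -> self_adjoint A ->
  (forall i, A (e i) = lam i *: e i) ->
  (forall u, u \in U -> u != 0 -> ip (A u) u < 0) ->
  (\dim U <= #|[pred i | (lam i < 0)%R]|)%N.
Proof.
move=> ee symA Ae Uneg.
have symNA : self_adjoint (- A).
  by move=> u v; rewrite !opp_lfunE linearNl linearNr /= symA.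
have NAe i : (- A)%VF (e i) = (- lam i) *: e i.
  by rewrite opp_lfunE Ae scaleNr.
have NAU u : u \in U -> u != 0 -> 0 < ip ((- A)%VF u) u.
  by move=> uU u0; rewrite opp_lfunE linearNl oppr_gt0 Uneg.
have := dim_positive_le ee symNA NAe NAU.
by rewrite (eq_card (_ : _ =i [pred i | (lam i < 0)%R])) // => i; rewrite !inE oppr_gt0.
Qed.
End Spectral.

(** * Signature and trace in an orthonormal basis *)

(** Turns the sums over all real numbers in [signature] into counts of indices: the support lies in
    the finite list of values of [f], and the fibers partition the indices. *)
Lemma fsbig_card_fiber (I : finType) (T : choiceType) (f : I -> T) (P : pred T) :
  \big[addn/0%N]_(a \in [set a : T | P a]%classic) #|[pred i | f i == a]| =
  #|[pred i | P (f i)]|.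
Proof.
rewrite (fsbigE (undup [seq f i | i <- enum I & P (f i)])) ?undup_uniq //; last 2 first.
- move=> a /=; rewrite mem_undup => fa; have /mapP[i + ->] := fa.
  by rewrite mem_filter => /andP[].
- move=> a /= Pa; rewrite mem_undup => nfa; apply: eq_card0 => i; rewrite !inE.
  apply: contraNF nfa => /eqP fi; apply/mapP; exists i => //.
  by rewrite mem_filter fi Pa mem_enum.
under eq_bigr => a _ do rewrite -sum1_card big_mkcond.
rewrite exchange_big -[RHS]sum1_card [RHS]big_mkcond /=; apply: eq_bigr => i _.
(* After the exchange, [i] contributes the number of occurrences of [f i] in a duplicate-free list,
   which is 1 or 0 according to [P (f i)]. *)
transitivity (count (pred1 (f i)) (undup [seq f i | i <- enum I & P (f i)])).
  rewrite -sum1_count big_mkcond [RHS]big_mkcond; apply: eq_big_seq => a.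
  rewrite mem_undup => ra; have /mapP[j + aE] := ra; rewrite mem_filter -aE.
  by case/andP => Pa _; rewrite mem_set // inE eq_sym.
rewrite count_uniq_mem ?undup_uniq // mem_undup.
rewrite inE; case: ifP => Pi; last first.
  suff -> : (f i \in [seq f i | i <- enum I & P (f i)]) = false by [].
  by apply/mapP => -[j + fij]; rewrite mem_filter -fij Pi.
by rewrite map_f // mem_filter Pi mem_enum.
Qed.

Section Signature.
Variables (R : realType) (V : vectType R) (ip : {dot V for idfun}).

Lemma signature_eigenbasis (e : 'I_(\dim {:V}) -> V) (A : 'End(V)) lam :
  (forall i j, ip (e i) (e j) = (i == j)%:R) -> self_adjoint ip A ->
  (forall i, A (e i) = lam i *: e i) ->
  signature A = (#|[pred i | (lam i < 0)%R]|, #|[pred i | (lam i == 0)%R]|,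
                 #|[pred i | (0 < lam i)%R]|).
Proof.
move=> ee symA Ae; rewrite /signature.
have dimE a : \dim (leigenspace A a) = #|[pred i | lam i == a]|.
  exact: (dim_leigenspace ee symA Ae).
rewrite -(fsbig_card_fiber lam (fun a => a < 0)) -(fsbig_card_fiber lam (fun a => 0 < a)).
rewrite -(dimE 0) /leigenspace scale0r subr0.
by congr (_, _, _); apply: eq_fsbigr => a _; exact: dimE.
Qed.

(** The trace is defined in [vbasis]; the two change-of-basis matrices are inverse to each other
    ([idE]), so cyclicity of the trace moves it to [e]. *)
Lemma lfun_trace_orthonormal (e : 'I_(\dim {:V}) -> V) (f : 'End(V)) :
  (forall i j, ip (e i) (e j) = (i == j)%:R) ->
  lfun_trace f = \sum_i ip (f (e i)) (e i).
Proof.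
move=> ee; pose b := vbasis {:V}; have bB : basis_of {:V} b by exact: vbasisP.
pose t := [tuple e i | i < \dim {:V}].
have tE (i : 'I__) : t`_i = e i by rewrite nth_mktuple.
have tfree : free t.
  rewrite -[tval t]/[seq e i | i <- enum 'I__].
  exact: orthonormal_free ee (enum_uniq _).
have tB : basis_of {:V} t by rewrite basisEfree tfree subvf size_tuple leqnn.
have idE : mxof b t \1 *m mxof t b \1 = 1%:M.
  by rewrite -mxof_comp // comp_lfun1l mxof1 // (basis_free bB).
transitivity (\tr (mxof t t f)).
  have -> : mxof t t f = mxof t b \1 *m (mxof b b f *m mxof b t \1).
    by rewrite -(mxof_comp _ _ bB) comp_lfun1l -(mxof_comp _ _ bB) comp_lfun1r.
  by rewrite mxtrace_mulC -mulmxA idE mulmx1.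
apply: eq_bigr => i _; rewrite !mxE /= vecof_delta tE.
have := coord_sum_free (fun j => ip (f (e i)) (e j)) i tfree.
under eq_bigr => j _ do rewrite tE.
by rewrite -(orthonormal_expansion ee (f (e i))).
Qed.

(** Each application of [f] goes one step down the chain, so the m-th iterate is zero and the matrix
    of [f] is nilpotent. *)
Lemma lfun_trace_nilpotent (f : 'End(V)) (C : nat -> {vspace V}) m :
  C 0%N = fullv -> (forall i v, v \in C i -> f v \in C i.+1) -> C m = 0%VS ->
  lfun_trace f = 0.
Proof.
move=> C0 fC Cm; rewrite /lfun_trace; set M := mxof _ _ f.
have bB := vbasisP {:V}; apply: (mxtrace_nilpotent (k := m)) => v.
have iterM k : iter k (mulmxr M) v =
    rVof (vbasis {:V}) (iter k f (vecof (vbasis {:V}) v)).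
  elim: k => [|k IH]; first by rewrite /= vecofK.
  by rewrite !iterS IH /= -rVof_app.
have iterC k u : iter k f u \in C k.
  by elim: k => [|k IH]; [rewrite C0 memvf|rewrite iterS fC].
have := iterC m (vecof (vbasis {:V}) v); rewrite Cm memv0 iterM => /eqP ->.
by rewrite linear0.
Qed.
End Signature.

(** * Ricci form of a nilpotent metric Lie algebra *)

Lemma sum_antisym (R : numDomainType) (I : finType) (F : I -> I -> R) :
  (forall i j, F j i = - F i j) -> \sum_i \sum_j F i j = 0.
Proof.
move=> antiF; apply/eqP; rewrite -eqNr -sumrN exchange_big /=; apply/eqP.
by apply: eq_bigr => i _; rewrite -sumrN; apply: eq_bigr => j _; rewrite -antiF.
Qed.

Lemma sum_sqr_le0 (R : realDomainType) (I : finType) (F : I -> I -> R) :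
  \sum_i \sum_j F i j ^+ 2 <= 0 -> forall i j, F i j = 0.
Proof.
have row_ge0 i : 0 <= \sum_j F i j ^+ 2 by apply: sumr_ge0 => j _; exact: sqr_ge0.
rewrite le_eqVlt ltNge sumr_ge0 // orbF psumr_eq0 // => /allP F0 i j.
have := F0 i (mem_index_enum _); rewrite /= psumr_eq0 => [/allP/(_ j)|k _].
  by rewrite mem_index_enum /= sqrf_eq0 => /(_ isT)/eqP.
exact: sqr_ge0.
Qed.

Section NilpotentLie.
Variables (K : fieldType) (g : lieAlgType K).

Lemma lower_central_anti i : (lower_central g i.+1 <= lower_central g i)%VS.
Proof.
elim: i => [|i IH]; first exact: subvf.
apply/lie_span_subP => x y _ yC.
by apply: memv_lie; [exact: memvf|exact: (subvP IH)].
Qed.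
End NilpotentLie.

Section Ricci.
Variables (R : realType) (g : lieAlgType R) (ip : {dot g for idfun}).
Hypothesis g_nilpotent : nilpotent_lie g.
Variable e : 'I_(\dim {:g}) -> g.
Hypothesis ee : forall i j, ip (e i) (e j) = (i == j)%:R.
Implicit Types (u v w x y : g).

(** Unimodularity: ad x moves down the lower central series, so it is nilpotent. *)
Lemma trace_ad x : \sum_i ip (lie x (e i)) (e i) = 0.
Proof.
have [m Cm] := g_nilpotent.
transitivity (lfun_trace (linfun (lie x))).
  by rewrite (lfun_trace_orthonormal _ ee); apply: eq_bigr => i _; rewrite lfunE.
apply: (lfun_trace_nilpotent (C := lower_central g)) Cm => // i v vC.
by rewrite lfunE /= memv_lie ?memvf.
Qed.

(** Vanishing of the Killing form: the composite of two ad's descends two steps of the lower central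
    series, hence at least one. *)
Lemma trace_ad_comp x y :
  \sum_i \sum_j ip (lie x (e i)) (e j) * ip (lie y (e j)) (e i) = 0.
Proof.
have [m Cm] := g_nilpotent.
transitivity (lfun_trace (linfun (lie y) \o linfun (lie x))%VF).
  rewrite (lfun_trace_orthonormal _ ee); apply: eq_bigr => i _.
  rewrite comp_lfunE !lfunE /= {2}(orthonormal_expansion ee (lie x (e i))).
  rewrite linear_sumr linear_sumlz; apply: eq_bigr => j _.
  by rewrite linearZr_LR /= linearZl_LR.
apply: (lfun_trace_nilpotent (C := lower_central g)) Cm => // i v vC.
rewrite comp_lfunE !lfunE /=; apply: memv_lie; first exact: memvf.
by apply: (subvP (lower_central_anti g i)); apply: memv_lie; rewrite ?memvf.
Qed.

Let a x i j := ip (lie x (e i)) (e j).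
Let c x i j := ip (lie (e i) (e j)) x.

(** Polarized form of the formula for ric(u, u), symmetric in [v] and [w] at sight. The Killing
    terms, i.e. the products of [a v i j] with [a w j i], are still present here. *)
Lemma ricci_nilpotentE v w : ricci ip v w =
  - 4^-1 * \sum_i \sum_j ((a v i j + a v j i) * (a w i j + a w j i) - c v i j * c w i j).
Proof.
rewrite /ricci (lfun_trace_orthonormal _ ee).
pose L x i j := ip (levi_civita ip x (e i)) (e j).
pose M i j := ip (levi_civita ip (e i) w) (e j).
(* The three terms of the curvature: Koszul's formula on the first, metric compatibility and
   Parseval on the second, expansion of [e i, v] in the third. The first then sums to zero by
   [trace_ad]. *)
transitivity (\sum_i (- ip (lie (levi_civita ip v w) (e i)) (e i) +
    \sum_j (M i j * L v i j - ip (lie (e i) v) (e j) * M j i))).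
  apply: eq_bigr => i _; rewrite curvature_lfunE /curvature !linearBl /=.
  rewrite -addrA; congr (_ + _).
    rewrite levi_civitaE liexx linear0l (lieC (e i)) linearNl /=; lra.
  rewrite sumrB; congr (_ - _).
    have := levi_civita_metric ip v (levi_civita ip (e i) w) (e i).
    move/(canRL (addrK _)); rewrite add0r => ->; rewrite opprK.
    exact: (parseval ee).
  rewrite {1}(orthonormal_expansion ee (lie (e i) v)) !linear_sumlz.
  by apply: eq_bigr => j _; rewrite !linearZl_LR.
rewrite big_split /= sumrN trace_ad oppr0 add0r.
(* Exchanging [i] and [j] in the last sum makes [M i j] a common factor. *)
transitivity (\sum_i \sum_j (M i j * L v i j - ip (lie (e j) v) (e i) * M i j)).
  under eq_bigr => i _ do rewrite sumrB.
  under [RHS]eq_bigr => i _ do rewrite sumrB.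
  by rewrite !sumrB [X in _ - X]exchange_big.
have LE x i j : L x i j = (a x i j - c x i j - a x j i) / 2.
  rewrite /L /a /c levi_civitaE (lieC (e j) x) linearNl /=; lra.
have ME i j : M i j = - (a w i j + a w j i + c w i j) / 2.
  rewrite /M /a /c levi_civitaE (lieC (e i) w) (lieC (e j) (e i)) !linearNl /=; lra.
(* A factor symmetric in [i], [j] against an antisymmetric one. *)
have cross x y : \sum_i \sum_j (a x i j + a x j i) * c y i j = 0.
  apply: sum_antisym => i j; rewrite /c (lieC (e j)) linearNl /=; lra.
(* Reinserting the vanishing cross terms makes both sides agree summand by summand. *)
transitivity (- 4^-1 *
    (\sum_i \sum_j ((a v i j + a v j i) * (a w i j + a w j i) - c v i j * c w i j)
     + \sum_i \sum_j (a v i j + a v j i) * c w i j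
     - \sum_i \sum_j (a w i j + a w j i) * c v i j)); last first.
  by rewrite !cross addr0 subr0.
rewrite -big_split -sumrB mulr_sumr; apply: eq_bigr => i _.
rewrite -big_split -sumrB mulr_sumr; apply: eq_bigr => j _ /=.
rewrite LE ME (lieC (e j) v) linearNl /= -/(a v j i).
lra.
Qed.

Lemma ricciC v w : ricci ip v w = ricci ip w v.
Proof.
rewrite !ricci_nilpotentE; congr (_ * _).
by apply: eq_bigr => i _; apply: eq_bigr => j _; ring.
Qed.

Lemma ricci_center_perp z w : z \in center g ->
  z \in orthov ip (derived_ideal g) -> ricci ip z w = 0.
Proof.
move=> /centerP zZ /mem_orthovP zD; rewrite ricci_nilpotentE.
have aE i j : a z i j = 0 by rewrite /a zZ linear0l.
have cE i j : c z i j = 0 by rewrite /c ipC; apply/zD/memv_lie; rewrite memvf.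
by rewrite big1 ?mulr0 // => i _; rewrite big1 // => j _; rewrite !aE !cE; ring.
Qed.

(** All [c u i j] vanish, so ric(u, u) is - 1/2 times the sum of the squares of the entries of ad u.
    If it were nonnegative, ad u would be zero. *)
Lemma ricci_derived_perp_lt0 u : u \in orthov ip (derived_ideal g) ->
  u \notin center g -> ricci ip u u < 0.
Proof.
move=> /mem_orthovP uD; apply: contraNT; rewrite -leNgt ricci_nilpotentE => ric_ge0.
have cE i j : c u i j = 0 by rewrite /c ipC; apply/uD/memv_lie; rewrite memvf.
have trE :
    \sum_i \sum_j ((a u i j + a u j i) * (a u i j + a u j i) - c u i j * c u i j) =
    2 * (\sum_i \sum_j a u i j ^+ 2).
  (* The mixed term of the expanded square is twice the Killing form at (u, u). *)
  transitivity (\sum_i \sum_j a u i j ^+ 2 + \sum_i \sum_j a u j i ^+ 2 +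
      2 * \sum_i \sum_j a u i j * a u j i).
    rewrite mulr_sumr -!big_split; apply: eq_bigr => i _ /=.
    rewrite mulr_sumr -!big_split; apply: eq_bigr => j _ /=.
    by rewrite cE; ring.
  rewrite [X in _ + X + _]exchange_big /= [X in 2 * X](trace_ad_comp u u) mulr0.
  by rewrite addr0 mulr_natl mulr2n.
have aE : forall i j, a u i j = 0.
  by apply: sum_sqr_le0; move: ric_ge0; rewrite trE; lra.
apply/centerP => y; rewrite (orthonormal_expansion ee y) linear_sumr big1 // => i _.
rewrite linearZr_LR /= (orthonormal_expansion ee (lie u (e i))) big1 ?scaler0 // => j _.
by rewrite -/(a u i j) aE scale0r.
Qed.

(** Only the [c] terms survive. Were ric(u, u) nonpositive, they would all vanish, so [u] would be
    orthogonal to the derived ideal and, lying in it, to itself. *)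
Lemma ricci_center_derived_gt0 u : u \in center g -> u \in derived_ideal g ->
  u != 0 -> 0 < ricci ip u u.
Proof.
move=> /centerP uZ uD; apply: contraNT; rewrite -leNgt ricci_nilpotentE => ric_le0.
have aE i j : a u i j = 0 by rewrite /a uZ linear0l.
have ricE :
    \sum_i \sum_j ((a u i j + a u j i) * (a u i j + a u j i) - c u i j * c u i j) =
    - \sum_i \sum_j c u i j ^+ 2.
  rewrite -sumrN; apply: eq_bigr => i _; rewrite -sumrN; apply: eq_bigr => j _.
  by rewrite !aE; ring.
have cE : forall i j, c u i j = 0.
  by apply: sum_sqr_le0; move: ric_le0; rewrite ricE; lra.
have DP : (derived_ideal g <= orthov ip <[u]>)%VS.
  apply/lie_span_subP => x y _ _; rewrite mem_orthov_line.
  rewrite (orthonormal_expansion ee x) linear_sumlz linear_sumlz big1 // => i _.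
  rewrite (orthonormal_expansion ee y) linear_sumr linear_sumlz big1 // => j _.
  by rewrite linearZl_LR linearZr_LR /= !linearZl_LR /= -/(c u i j) cE !mulr0.
by have := subvP DP _ uD; rewrite mem_orthov_line dot_eq0.
Qed.

End Ricci.

(** * Signature of the Ricci operator *)

Theorem theorem1 (R : realType) (g : lieAlgType R) (ip : {dot g for idfun})
    (g_nilpotent : nilpotent_lie g) :
  Sign g (signature (ricci_operator ip)).
Proof.
(* Symmetry of ric is computed in some orthonormal basis [e0]; only then does the spectral theorem
   provide the eigenbasis [e]. *)
have [e0 _ ee0] := exists_orthonormal_basis ip {:g}.
pose Ric := ricci_operator ip.
have symRic : self_adjoint ip Ric.
  by move=> u v; rewrite (ipC ip u) !ricci_operatorE (ricciC g_nilpotent ee0).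
have [e [lam [_ ee Rice]]] :=
  spectral_theorem_on symRic (subvf (Ric @: fullv)) (erefl (\dim {:g})).
have sigE := signature_eigenbasis ee symRic Rice.
set D := derived_ideal g; set Z := center g; pose O := orthov ip D.
have dimDO : (\dim D + \dim O)%N = \dim {:g} by exact: dim_orthov.
have dimZO := dimv_sum_cap Z O.
have dim_ZO_le : (\dim (Z + O) <= \dim {:g})%N by exact: dimvS (subvf _).
have dimZDZO : (\dim (Z :&: D) + \dim (Z :&: O) <= \dim Z)%N.
  rewrite -dimv_disjoint_sum; first by apply: dimvS; rewrite subv_add !capvSl.
  by apply/eqP; rewrite -subv0 -(capv_orthov ip D) capvS ?capvSr.
have dimOZ := dimv_cap_compl O Z.
have lDle : (\dim (Z :&: D) <= \dim D)%N by apply/dimvS/capvSr.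
(* [O :\: Z] is a complement of [O :&: Z] in [O], so its nonzero vectors are not central. *)
have neg_ge : (\dim (O :\: Z) <= #|[pred i | (lam i < 0)%R]|)%N.
  apply: (dim_negative_le ee symRic Rice) => u uOZ u0.
  rewrite ricci_operatorE; apply: (ricci_derived_perp_lt0 g_nilpotent ee).
    exact: subvP (diffvSl O Z) _ uOZ.
  apply: contraNN u0 => uZ.
  by rewrite -memv0 -(capv_diff O Z) memv_cap uOZ.
have zero_ge : (\dim (Z :&: O) <= #|[pred i | (lam i == 0)%R]|)%N.
  have [_ <- _] := sigE; apply/dimvS/subvP => z /memv_capP[zZ zO].
  rewrite memv_ker -(dot_eq0 ip) ricci_operatorE.
  by rewrite (ricci_center_perp g_nilpotent ee).
have pos_ge : (\dim (Z :&: D) <= #|[pred i | (0 < lam i)%R]|)%N.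
  apply: (dim_positive_le ee symRic Rice) => u /memv_capP[uZ uD] u0.
  by rewrite ricci_operatorE (ricci_center_derived_gt0 g_nilpotent ee).
have card_sum : (#|[pred i | (lam i < 0)%R]| + #|[pred i | (lam i == 0)%R]| +
    #|[pred i | (0 < lam i)%R]|)%N = \dim {:g}.
  rewrite -[RHS]card_ord -!sum1_card !(big_mkcond (fun i => i \in _)) /= -!big_split /=.
  by apply: eq_bigr => i _; rewrite !inE; case: ltrgt0P.
rewrite capvC in dimOZ.
(* Here p = dim (Z :&: O). The bound k - d <= p comes from dim (Z + O) <= n, and p <= k - l from the
   direct sum of Z :&: D and Z :&: O inside Z. *)
have counts (n d k l p oz o zo s1 s2 s3 : nat) : (d + o = n)%N ->
    (zo + p = k + o)%N -> (zo <= n)%N -> (l + p <= k)%N -> (l <= d)%N ->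
    (p + oz = o)%N -> (oz <= s1)%N -> (p <= s2)%N -> (l <= s3)%N ->
    (s1 + s2 + s3 = n)%N ->
  exists q m_neg m_zero m_pos : nat,
    [/\ (maxn (k - d) 0 <= q <= k - l)%N, (m_neg + m_zero + m_pos = d - l)%N &
        (s1, s2, s3) = (n - d - q + m_neg, q + m_zero, l + m_pos)%N].
  (* The m's are the excesses of the three counts over their lower bounds; those bounds add up to oz
     + p + l = n - d + l, which leaves d - l. *)
  move=> *; exists p, (s1 - oz)%N, (s2 - p)%N, (s3 - l)%N.
  by split; [apply/andP; split; lia|lia|congr (_, _, _); lia].
rewrite sigE; exact: counts dimDO dimZO dim_ZO_le dimZDZO lDle dimOZ neg_ge
  zero_ge pos_ge card_sum.
Qed.
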